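(* Let $f:\mathbb{R}^d\to\mathbb{R}$ be convex, differentiable, and $L$-smooth (with respect to $\|\cdot\|_2$), for $L>0$. Let $\theta_0\in\mathbb{R}^d$ and consider the gradient descent iterates $\theta_{t+1}=\theta_t-\eta_t\nabla f(\theta_t)$ with step sizes $\eta_t\in(0,1/L]$, $t=0,1,2,\dots$. Let $f^\star=\inf_{\theta\in\mathbb{R}^d}f(\theta)\in[-\infty,\infty)$ and let $S=\{\theta\in\mathbb{R}^d:f(\theta)=f^\star\}$ be the solution set (a closed convex set). The following holds. 1. (Objective convergence.) If $\sum_{t=0}^\infty\eta_t=\infty$, then $\lim_{t\to\infty}f(\theta_t)=f^\star$. 2. (Nonincreasing distance to solution set.) If $S\ne\emptyset$, then $\{\|\theta_t-s\|_2\}_{t=0}^\infty$ is nonincreasing for any $s\in S$, and thus $\{\mathrm{dist}_S(\theta_t)\}_{t=0}^\infty$ is nonincreasing. 3. (Iterate convergence.) If $S\ne\emptyset$ and $\sum_{t=0}^\infty\eta_t=\infty$, then $\lim_{t\to\infty}\theta_t=\theta_\infty\in S$ (the limit exists and lies in $S$). Furthermore, $\|\theta_\infty-\Pi_S(\theta_0)\|_2\le\mathrm{dist}_S(\theta_0)$, and thus $\|\theta_\infty-\theta_0\|_2\le 2\,\mathrm{dist}_S(\theta_0)$. 4. (Projection onto the solution set.) If $S\ne\emptyset$, $\sum_{t=0}^\infty\eta_t=\infty$, and $S$ is affine, then $\theta_\infty=\Pi_S(\theta_0)$.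
   Context: A differentiable function $f$ is $L$-smooth with respect to $\|\cdot\|_2$ if $\|\nabla f(x)-\nabla f(y)\|_2\le L\|x-y\|_2$ for all $x,y$. For a set $S\subseteq\mathbb{R}^d$, $\Pi_S(u)=\arg\min_{s\in S}\|u-s\|_2$ denotes the projection of a point $u$ onto $S$, and $\mathrm{dist}_S(u)=\min_{s\in S}\|u-s\|_2$ the distance from $u$ to $S$. *)

(* Defs.v *)
From HB Require Import structures.
From mathcomp Require Import all_boot all_order all_algebra.
From mathcomp Require Import all_classical all_reals all_analysis.

Set Implicit Arguments.
Unset Strict Implicit.
Unset Printing Implicit Defensive.

Import Order.TTheory GRing.Theory Num.Theory.
Import numFieldNormedType.Exports.

Local Open Scope classical_set_scope.
Local Open Scope ring_scope.

(* The library norm `|x| on 'rV[R]_d is the sup norm. It induces the usual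
   topology, and hence the usual limits and differentials, of R^d; the
   Euclidean norm is the following one. *)
Definition l2norm (R : realType) (d : nat) (x : 'rV[R]_d) : R :=
  Num.sqrt (\sum_(i < d) x 0 i ^+ 2).

Definition gradient (R : realType) (d : nat) (f : 'rV[R]_d -> R)
    (x : 'rV[R]_d) : 'rV[R]_d :=
  \row_(i < d) 'D_(delta_mx 0 i) (f : 'rV[R]_d -> R^o) x.

Definition l2_smooth (R : realType) (d : nat) (L : R) (f : 'rV[R]_d -> R) :=
  forall x y : 'rV[R]_d,
    l2norm (gradient f x - gradient f y) <= L * l2norm (x - y).

Definition inf_value (R : realType) (d : nat) (f : 'rV[R]_d -> R) : \bar R :=
  ereal_inf [set (f x)%:E | x in [set: 'rV[R]_d]].

Definition solution_set (R : realType) (d : nat) (f : 'rV[R]_d -> R) :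
    set 'rV[R]_d :=
  [set x | (f x)%:E = inf_value f].

(* The default value 0 of xget is returned only when there is no minimum
   (resp. no minimizer). On a nonempty closed convex S, both exist and the
   minimizer is unique. *)
Definition l2dist (R : realType) (d : nat) (S : set 'rV[R]_d)
    (u : 'rV[R]_d) : R :=
  let D := [set l2norm (u - s) | s in S] in xget 0 (D `&` lbound D).

Definition l2proj (R : realType) (d : nat) (S : set 'rV[R]_d)
    (u : 'rV[R]_d) : 'rV[R]_d :=
  xget 0 [set p | S p /\ forall s, S s -> l2norm (u - p) <= l2norm (u - s)].

Definition affine_set (R : realType) (d : nat) (S : set 'rV[R]_d) :=
  forall (x y : 'rV[R]_d) (t : R), S x -> S y -> S ((1 - t) *: x + t *: y).

(* Main.v *)
Require Import Defs.
From HB Require Import structures.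
From mathcomp Require Import all_boot all_order all_algebra.
From mathcomp Require Import all_classical all_reals all_analysis.
From mathcomp Require Import ring lra.

Import Order.TTheory GRing.Theory Num.Theory.
Import numFieldNormedType.Exports.

Local Open Scope classical_set_scope.
Local Open Scope ring_scope.

(** Everything follows from one inequality ([gradient_step_dist]): for a
gradient step from [x] to [x'] of length [eta <= 1 / L] and for every point [z],
the squared distance [l2norm (x' - z) ^+ 2] is at most
[l2norm (x - z) ^+ 2 - 2 * eta * (f x' - f z)].
It combines the descent lemma for smooth functions, which bounds [f x'] by its
quadratic model at [x] ([smooth_descent]), with the first-order lower bound for
convex functions ([convex_first_order]).

With [z] the current iterate, the inequality shows that the values [f (theta t)]
decrease ([descent_nonincreasing]). With an arbitrary [z], summing over [t]
bounds any gap to [f z] common to all iterates, times the sum of the step sizes,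
by the initial squared distance ([descent_rate]); if the step sizes have an
infinite sum, no positive gap can persist ([descent_cvg_inf]). Since [z] is
arbitrary, this covers an infimum that is not attained or is [-oo].
With [z] a solution, it shows that the distance to every solution is
nonincreasing ([descent_fejer]).

Monotone distances confine the iterates to a ball, so they have a cluster point;
by continuity of [f] it is a solution, and then the monotone distance to it must
tend to [0] ([fejer_cvg]). In the limit, the limit point is at least as close to
every solution as [theta 0] is; the choice of the projection of [theta 0] for
the solution gives the bounds on the limit, and when the solution set is affine
this comparison along the line through the limit and the projection leaves no
choice but the projection itself ([affine_nonexpansive_l2proj]). *)

(** * Euclidean geometry *)

Section Euclidean.
Context {R : realType} {d : nat}.
Implicit Types u v w : 'rV[R]_d.

Definition dot u v : R := \sum_(i < d) u 0 i * v 0 i.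

Lemma dotC u v : dot u v = dot v u.
Proof. by apply: eq_bigr => i _; rewrite mulrC. Qed.

Lemma dotDl u v w : dot (u + v) w = dot u w + dot v w.
Proof. by rewrite -big_split; apply: eq_bigr => i _; rewrite mxE mulrDl. Qed.

Lemma dotZl (a : R) u v : dot (a *: u) v = a * dot u v.
Proof. by rewrite mulr_sumr; apply: eq_bigr => i _; rewrite mxE mulrA. Qed.

Lemma dotNl u v : dot (- u) v = - dot u v.
Proof. by rewrite -scaleN1r dotZl mulN1r. Qed.

Lemma dotDr u v w : dot u (v + w) = dot u v + dot u w.
Proof. by rewrite dotC dotDl !(dotC u). Qed.

Lemma dotZr (a : R) u v : dot u (a *: v) = a * dot u v.
Proof. by rewrite dotC dotZl dotC. Qed.

Lemma dotNr u v : dot u (- v) = - dot u v.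
Proof. by rewrite dotC dotNl dotC. Qed.

Definition dotE := (dotDl, dotDr, dotNl, dotNr, dotZl, dotZr).

Lemma l2norm_ge0 u : 0 <= l2norm u.
Proof. exact: sqrtr_ge0. Qed.

Lemma l2norm_sqr u : l2norm u ^+ 2 = dot u u.
Proof. by rewrite sqr_sqrtr// sumr_ge0// => i _; rewrite sqr_ge0. Qed.

Lemma l2norm0 : l2norm (0 : 'rV[R]_d) = 0.
Proof. by apply/eqP; rewrite -sqrf_eq0 l2norm_sqr -(scale0r 0) dotZl mul0r. Qed.

Lemma l2normZ (a : R) u : l2norm (a *: u) = `|a| * l2norm u.
Proof.
apply: (@pexpIrn _ 2) => //; rewrite ?nnegrE ?mulr_ge0 ?l2norm_ge0//.
by rewrite exprMn !l2norm_sqr !dotE real_normK ?num_real// mulrA expr2.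
Qed.

Lemma l2normBC u v : l2norm (u - v) = l2norm (v - u).
Proof. by rewrite -opprB -scaleN1r l2normZ normrN1 mul1r. Qed.

Lemma normr_coord_le_l2norm u i : `|u 0 i| <= l2norm u.
Proof.
rewrite -sqrtr_sqr ler_wsqrtr// (bigD1 i)//= lerDl sumr_ge0// => j _.
exact: sqr_ge0.
Qed.

Lemma mx_norm_le_l2norm u : `|u| <= l2norm u.
Proof.
rewrite -[leLHS]/(mx_norm u) mx_normrE; apply/bigmax_leP.
split=> [|[i j] _]/=; first exact: l2norm_ge0.
by rewrite ord1 normr_coord_le_l2norm.
Qed.

Lemma l2norm_eq0 u : l2norm u = 0 -> u = 0.
Proof.
by move=> u0; apply/normr0_eq0/le_anti; rewrite normr_ge0 -u0 mx_norm_le_l2norm.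
Qed.

(** Nonnegativity of [l2norm (l2norm v *: u - l2norm u *: v) ^+ 2], divided by
[2 * l2norm u * l2norm v]. *)
Lemma cauchy_schwarz u v : dot u v <= l2norm u * l2norm v.
Proof.
have [/eqP|u0] := boolP (l2norm u == 0).
  by move=> /l2norm_eq0 ->; rewrite -(scale0r 0) dotZl l2normZ normr0 !mul0r.
have [/eqP|v0] := boolP (l2norm v == 0).
  move=> /l2norm_eq0 ->.
  by rewrite -(scale0r 0) dotZr l2normZ normr0 !mul0r mulr0.
have ab : 0 < l2norm u * l2norm v.
  by rewrite mulr_gt0// lt_neqAle eq_sym l2norm_ge0 ?u0 ?v0.
rewrite -subr_ge0 -(pmulr_rge0 _ ab).
have := sqr_ge0 (l2norm (l2norm v *: u - l2norm u *: v)).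
rewrite l2norm_sqr !dotE -!l2norm_sqr (dotC v u); nra.
Qed.

Lemma l2normD u v : l2norm (u + v) <= l2norm u + l2norm v.
Proof.
rewrite -(@ler_pXn2r _ 2) ?nnegrE ?addr_ge0 ?l2norm_ge0//.
rewrite l2norm_sqr !dotE (dotC v u) sqrrD -!l2norm_sqr.
have := cauchy_schwarz u v; lra.
Qed.

Lemma l2norm_continuous : continuous (@l2norm R d).
Proof.
move=> u.
have cs : continuous (fun v : 'rV[R]_d => \sum_(i < d) v 0 i ^+ 2).
  apply: continuous_big => [|i _ v]; first exact: add_continuous.
  apply: (@continuous_comp _ _ _ (fun w : 'rV[R]_d => w 0 i) (fun x => x ^+ 2)).
    exact: coord_continuous.
  exact: exprn_continuous.
exact: continuous_comp (cs u) (@sqrt_continuous R _).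
Qed.

Lemma l2normB_continuous v : continuous (fun u : 'rV[R]_d => l2norm (u - v)).
Proof.
move=> u; apply: (@continuous_comp _ _ _ (fun w => w - v) (@l2norm R d)).
  by apply: continuousB; [move=> A; apply | exact: cst_continuous].
exact: l2norm_continuous.
Qed.

(** [l2norm] dominates the sup norm, so Euclidean balls are bounded for the norm
that defines the topology; they are closed because [l2norm] is continuous. *)
Lemma l2ball_compact v (r : R) :
  compact [set u : 'rV[R]_d | l2norm (u - v) <= r].
Proof.
apply: bounded_closed_compact; last first.
  apply: (@preimage_closed _ _ (fun u => l2norm (u - v)) [set x | x <= r]).
    by move=> u _; exact: l2normB_continuous.
  exact: closed_le.
exists (r + `|v|); split; first exact: num_real.
move=> M rM u /= ur; apply/ltW/(le_lt_trans _ rM).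
rewrite -[u in leLHS](subrK v) (le_trans (ler_normD _ _))// lerD2r.
exact: le_trans (mx_norm_le_l2norm _) ur.
Qed.

End Euclidean.

(** * Convex and smooth functions *)

Section Smooth.
Context {R : realType} {d : nat} (f : 'rV[R]_d -> R).
Hypothesis f_diff : forall x : 'rV[R]_d, differentiable (f : 'rV[R]_d -> R^o) x.

Lemma derive_gradient (x h : 'rV[R]_d) :
  'D_h (f : 'rV[R]_d -> R^o) x = dot (gradient f x) h.
Proof.
rewrite deriveE// [in LHS](row_sum_delta h) linear_sum.
by apply: eq_bigr => i _; rewrite linearZ/= mxE -deriveE// mulrC.
Qed.

(** Difference quotients of the restriction of [f] to a line are those of [f] in
the direction [h] of the line, term by term. *)
Lemma is_derive_line (x h : 'rV[R]_d) (t : R) :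
  is_derive t 1 (fun s : R => f (x + s *: h) : R^o)
    (dot (gradient f (x + t *: h)) h).
Proof.
rewrite -derive_gradient.
have lineE :
    (fun r : R => r^-1 *:
       ((f (x + (r *: 1 + t) *: h) : R^o) - f (x + t *: h))) =
    (fun r : R => r^-1 *:
       ((f (r *: h + (x + t *: h)) : R^o) - f (x + t *: h))).
  apply/funext => r; congr (_ *: (f _ - _)).
  by rewrite -[r *: 1]/(r * 1) mulr1 scalerDl addrCA.
split.
- have := @diff_derivable _ _ _ _ _ h (f_diff (x + t *: h)).
  by rewrite /derivable -lineE.
- by rewrite /derive -lineE.
Qed.

(** Along the segment from [x] to [y], convexity bounds every difference
quotient at [x] by [f y - f x]; the bound passes to the right limit at [0]. *)
Lemma convex_first_order (x y : 'rV[R]_d) :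
  convex_function [set: convex_lmodType 'rV[R]_d] f ->
  f x + dot (gradient f x) (y - x) <= f y.
Proof.
move=> f_convex; rewrite -lerBrDl -derive_gradient.
have /cvg_dnbhs_at_right cvgD := @diff_derivable _ _ _ _ _ (y - x) (f_diff x).
apply: (cvgr_to_le cvgD); near=> t.
have t0 : 0 < t by near: t; exact: nbhs_right_gt.
have t1 : t <= 1 by near: t; exact: nbhs_right_le.
have cvx : f (t *: y + (1 - t) *: x) <= t * f y + (1 - t) * f x.
  exact: f_convex (Itv01 (ltW t0) t1) y x (mem_set I) (mem_set I).
rewrite -[leLHS]/(t^-1 * (f (t *: (y - x) + x) - f x)).
have -> : t *: (y - x) + x = t *: y + (1 - t) *: x.
  by rewrite scalerBr scalerBl scale1r addrAC addrA.
rewrite mulrC ler_pdivrMr//.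
move: cvx; nra.
Unshelve. all: by end_near. Qed.

(** The difference between [f] and its quadratic upper model, restricted to the
segment from [x] to [x + h], has at time [t] the derivative
[dot (gradient f (x + t *: h) - gradient f x) h - t * L * l2norm h ^+ 2], which
is nonpositive for [0 <= t] by Cauchy-Schwarz and smoothness. *)
Lemma smooth_descent (L : R) (x h : 'rV[R]_d) : l2_smooth L f ->
  f (x + h) <= f x + dot (gradient f x) h + L / 2 * l2norm h ^+ 2.
Proof.
move=> f_smooth.
pose c := dot (gradient f x) h.
pose psi := fun t : R =>
  f (x + t *: h) - t * c - L / 2 * l2norm h ^+ 2 * t ^+ 2.
pose dpsi := fun t : R =>
  dot (gradient f (x + t *: h)) h - c - L * l2norm h ^+ 2 * t.
have psiD (t : R) : is_derive t 1 psi (dpsi t).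
  have := is_derive_line x h t => ?.
  apply: is_derive_eq.
  have scE (a b : R) : a *: (b : R^o) = a * b by [].
  by rewrite /dpsi !scE mulr0 mulr1; field.
have dpsi_le0 (t : R) : 0 <= t -> dpsi t <= 0.
  move=> t0; rewrite /dpsi /c subr_le0.
  have -> : dot (gradient f (x + t *: h)) h - dot (gradient f x) h =
            dot (gradient f (x + t *: h) - gradient f x) h by rewrite !dotE.
  apply: (le_trans (cauchy_schwarz _ _)).
  have := f_smooth (x + t *: h) x.
  rewrite (addrAC x (t *: h) (- x)) subrr add0r l2normZ ger0_norm// => Lip.
  rewrite [leRHS](_ : _ = L * (t * l2norm h) * l2norm h); last by ring.
  by apply: ler_wpM2r; [exact: l2norm_ge0|].
have psi_der (t : R) : derivable psi t 1 by have [] := psiD t.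
have : psi 1 <= psi 0.
  apply: (@ler0_derive1_nincr _ psi 0 1) => // [t|].
    rewrite in_itv/= => /andP[t0 _].
    by rewrite derive1E (@derive_val _ _ _ _ _ _ _ (psiD t)) dpsi_le0 ?ltW.
  exact: derivable_within_continuous.
rewrite /psi scale1r scale0r addr0 /c; lra.
Qed.

(** The descent inequality bounds the decrease of [f] below by half of
[eta * l2norm (gradient f x) ^+ 2], because [eta <= 1 / L]. This is what pays
for the second-order term of the expansion of the squared distance to [z];
convexity bounds the first-order term. The choice of [z] is left open because
three are used: minimizers give the monotone distances, the current iterate
gives the decrease of [f], arbitrary points give the rate. *)
Lemma gradient_step_dist (L eta : R) (x z : 'rV[R]_d) :
  convex_function [set: convex_lmodType 'rV[R]_d] f -> l2_smooth L f ->
  0 < L -> 0 < eta <= 1 / L ->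
  l2norm (x - eta *: gradient f x - z) ^+ 2 <=
    l2norm (x - z) ^+ 2 - 2 * eta * (f (x - eta *: gradient f x) - f z).
Proof.
move=> f_convex f_smooth L0 /andP[eta0]; rewrite ler_pdivlMr// => etaL.
set g := gradient f x; set x' := x - eta *: g.
have := smooth_descent L x (- (eta *: g)) f_smooth.
rewrite -/x' -/g l2norm_sqr !dotE => desc.
have := convex_first_order x z f_convex; rewrite -/g !dotE => conv.
have G0 : 0 <= dot g g by rewrite -l2norm_sqr sqr_ge0.
have second : L * eta * (eta * dot g g) <= eta * dot g g.
  by rewrite ler_piMl ?mulr_ge0 ?(ltW eta0)// mulrC.
have gap : f x' - f z <= dot g x - dot g z - eta / 2 * dot g g by nra.
have := ler_wpM2l (ltW eta0) gap.
rewrite !l2norm_sqr {1 2}/x' !dotE !(dotC _ g) (dotC z x); lra.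
Qed.

End Smooth.

(** * Projections and solution sets *)

Section Projection.
Context {R : realType} {d : nat}.
Implicit Types (S : set 'rV[R]_d) (u : 'rV[R]_d).

(** Only the compact part of [S] lying in a ball around [u] competes. *)
Lemma l2projP S u : closed S -> S !=set0 ->
  S (l2proj S u) /\ forall s, S s -> l2norm (u - l2proj S u) <= l2norm (u - s).
Proof.
move=> Sclosed [s0 Ss0].
pose A := S `&` [set x | l2norm (x - u) <= l2norm (s0 - u)].
have Ac : compact A.
  apply: (subclosed_compact _ (l2ball_compact u (l2norm (s0 - u)))).
    apply: closedI => //; exact: compact_closed (l2ball_compact _ _).
  by move=> x [].
have [||p] := EVT_min_rV (f := fun x => l2norm (x - u)) _ Ac.
- by exists s0; split => /=.
- by apply: continuous_subspaceT; exact: l2normB_continuous.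
rewrite inE => -[Sp _] pmin.
apply: (@xgetPex _ 0
  [set p | S p /\ forall s, S s -> l2norm (u - p) <= l2norm (u - s)]).
exists p; split => // s Ss; rewrite ![l2norm (u - _)]l2normBC.
have [su|/ltW us] := leP (l2norm (s - u)) (l2norm (s0 - u)).
  by apply: pmin; rewrite inE.
by apply: le_trans us; apply: pmin; rewrite inE; split => /=.
Qed.

Lemma l2distE S u : closed S -> S !=set0 ->
  l2dist S u = l2norm (u - l2proj S u).
Proof.
move=> Sclosed S0; have [Sp pmin] := l2projP S u Sclosed S0.
set D := [set l2norm (u - s) | s in S].
have [] : (D `&` lbound D) (l2dist S u).
  apply: xgetPex; exists (l2norm (u - l2proj S u)); split.
    by exists (l2proj S u).
  by move=> _ [s Ss <-]; exact: pmin.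
move=> [s Ss <-] lb; apply/le_anti; rewrite pmin// andbT.
by apply: lb; exists (l2proj S u).
Qed.

(** Apply the hypothesis to the point [p + tau *: (q - p)] of [S], where
[p := l2proj S u], and expand: [l2norm (q - p) ^+ 2 * (1 - 2 * tau)] is at most
[l2norm (u - p) ^+ 2 - 2 * tau * dot (u - p) (q - p)] for every real [tau].
A bound between affine functions of [tau] on the whole line forces equal
slopes, i.e. [l2norm (q - p) ^+ 2 = dot (u - p) (q - p)]. If that number were
positive, [q] would be closer to [u] than [p]. *)
Lemma affine_nonexpansive_l2proj S u q : closed S -> affine_set S -> S q ->
  (forall s, S s -> l2norm (q - s) <= l2norm (u - s)) -> q = l2proj S u.
Proof.
move=> Sclosed Saff Sq qS.
have [Sp pmin] := l2projP S u Sclosed (ex_intro _ q Sq).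
set p := l2proj S u in Sp pmin *.
pose a := u - p; pose v := q - p.
have line (tau : R) : dot v v * (1 - 2 * tau) <= dot a a - 2 * tau * dot a v.
  have Ss := Saff p q tau Sp Sq.
  have sE : (1 - tau) *: p + tau *: q = p + tau *: v.
    by rewrite scalerBl scale1r scalerBr addrAC addrA.
  have := qS _ Ss; rewrite sE.
  have -> : q - (p + tau *: v) = v - tau *: v by rewrite opprD addrA.
  have -> : u - (p + tau *: v) = a - tau *: v by rewrite opprD addrA.
  clearbody a v.
  rewrite -(@ler_pXn2r _ 2) ?nnegrE ?l2norm_ge0// !l2norm_sqr !dotE (dotC v a).
  by move=> ?; lra.
have slope : dot v v = dot a v.
  apply/eqP; apply: contraT => /eqP neq.
  pose c := dot v v - dot a v.
  have c0 : c != 0 by rewrite subr_eq0; apply/eqP.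
  (* at this [tau], [line] says that [dot v v - dot a a] is at most itself
     minus 1 *)
  have := line ((dot v v - dot a a - 1) / (2 * c)).
  have -> : (dot v v - dot a a - 1) / (2 * c) = (dot v v - dot a a - 1) / 2 / c.
    by field; rewrite c0.
  set k := (dot v v - dot a a - 1) / 2.
  have kc : k / c * c = k by rewrite divfK.
  by move: kc; rewrite {2}/c /k; lra.
have vv0 : dot v v = 0.
  apply/le_anti; rewrite -[X in _ && (_ <= X)]l2norm_sqr sqr_ge0 andbT.
  have := pmin q Sq.
  have -> : u - q = a - v by rewrite opprB addrA subrK.
  rewrite -/a; clearbody a v.
  rewrite -(@ler_pXn2r _ 2) ?nnegrE ?l2norm_ge0// !l2norm_sqr !dotE (dotC v a).
  by rewrite -slope; lra.
by apply/subr0_eq/l2norm_eq0/eqP; rewrite -sqrf_eq0 l2norm_sqr -/v vv0.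
Qed.

End Projection.

Section SolutionSet.
Context {R : realType} {d : nat} (f : 'rV[R]_d -> R).

Lemma inf_value_le x : (inf_value f <= (f x)%:E)%E.
Proof. by apply: ereal_inf_lbound; exists x. Qed.

Lemma solution_setP x : solution_set f x <-> forall y, f x <= f y.
Proof.
split=> [Sx y|xmin].
  by rewrite -lee_fin Sx inf_value_le.
apply/le_anti; rewrite inf_value_le andbT.
by apply: le_ereal_inf_tmp => _ [y _ <-]; rewrite lee_fin.
Qed.

Lemma closed_solution_set : continuous f -> closed (solution_set f).
Proof.
move=> fc.
have -> : solution_set f =
    \bigcap_(y in [set: 'rV[R]_d]) (f @^-1` [set r | r <= f y]).
  apply/seteqP; split => [x /solution_setP xmin y _|x xmin]; first exact: xmin.
  by apply/solution_setP => y; exact: xmin.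
apply: closed_bigI => y _; apply: preimage_closed; last exact: closed_le.
by move=> x _; exact: fc.
Qed.

Lemma convex_solution_set :
  convex_function [set: convex_lmodType 'rV[R]_d] f ->
  convex_set (solution_set f : set (convex_lmodType 'rV[R]_d)).
Proof.
move=> f_convex x y t; rewrite !inE => /solution_setP xmin /solution_setP ymin.
apply/solution_setP => z.
apply: (le_trans (f_convex t x y (mem_set I) (mem_set I))).
have -> : f y = f x by apply/le_anti; rewrite xmin ymin.
by rewrite convmm xmin.
Qed.

End SolutionSet.

(** * Gradient descent *)

Section Fejer.
Context {R : realType} {d : nat}.

(** A sequence that approaches every point of [S] monotonically is bounded,
hence has a cluster point [q]. Once [q] is known to lie in [S], the monotone
sequence of distances to [q] itself takes arbitrarily small values, so it tends
to [0]. *)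
Lemma fejer_cvg (S : set 'rV[R]_d) (x : nat -> 'rV[R]_d) : S !=set0 ->
  (forall s, S s -> nonincreasing_seq (fun t => l2norm (x t - s))) ->
  cluster (x t @[t --> \oo]) `<=` S ->
  exists2 q, S q & x t @[t --> \oo] --> q.
Proof.
move=> [s Ss] fejer clusterS.
have [|q [_ qcl]] :=
    l2ball_compact s (l2norm (x 0%N - s)) (x t @[t --> \oo]) _.
  by exists 0%N => // t _ /=; exact: fejer.
have Sq := clusterS q qcl; exists q => //.
apply/cvgrPdist_le => e e0.
have [_ [[N _ <-] ]] :
    [set x t | t in [set: nat]] `&` [set u | l2norm (u - q) < e] !=set0.
  apply: qcl; first by exists 0%N => // t _; exists t.
  have := @l2normB_continuous R d q q.
  by move=> /cvgr_lt; apply; rewrite subrr l2norm0.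
move=> /= ltN; exists N => // t /= Nt.
rewrite distrC (le_trans (mx_norm_le_l2norm _))//.
by rewrite (le_trans (fejer _ Sq _ _ Nt))// ltW.
Qed.

End Fejer.

Section Descent.
Context {R : realType} {d : nat} (f : 'rV[R]_d -> R).
Variables (eta : nat -> R) (theta : nat -> 'rV[R]_d).
Hypothesis eta_gt0 : forall t, 0 < eta t.
Hypothesis step_dist : forall t z,
  l2norm (theta t.+1 - z) ^+ 2 <=
    l2norm (theta t - z) ^+ 2 - 2 * eta t * (f (theta t.+1) - f z).

(** For [z] the current iterate, the right-hand side of [step_dist] is the
decrease of [f] times a positive factor. *)
Lemma descent_nonincreasing : nonincreasing_seq (f \o theta).
Proof.
apply/nonincreasing_seqP => t /=.
have := step_dist t (theta t); rewrite subrr l2norm0 expr0n/= sub0r.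
move=> /(le_trans (sqr_ge0 _)); rewrite oppr_ge0 pmulr_rle0 ?subr_le0//.
by rewrite mulr_gt0.
Qed.

(** The distances telescope; only the last one, which is nonnegative, is
dropped. *)
Lemma descent_rate (z : 'rV[R]_d) (delta : R) (T : nat) :
  (forall t, delta <= f (theta t) - f z) ->
  2 * delta * \sum_(0 <= t < T) eta t <= l2norm (theta 0%N - z) ^+ 2.
Proof.
move=> gap.
suff : l2norm (theta T - z) ^+ 2 + 2 * delta * \sum_(0 <= t < T) eta t <=
       l2norm (theta 0%N - z) ^+ 2.
  by apply: le_trans; rewrite lerDr sqr_ge0.
elim: T => [|T IH]; first by rewrite big_geq// mulr0 addr0.
rewrite big_nat_recr//=.
have := step_dist T z; have := ler_wpM2l (ltW (eta_gt0 T)) (gap T.+1).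
by move: IH; lra.
Qed.

Hypothesis eta_diverges : (\sum_(0 <= t <oo) (eta t)%:E = +oo)%E.

(** Were the infimum [m] of the values along the iterates larger than some
[f z], the gaps [f (theta t) - f z] would be at least [m - f z > 0], and the
rate would bound the partial sums of the step sizes. *)
Lemma descent_cvg_inf : (f (theta t))%:E @[t --> \oo] --> inf_value f.
Proof.
have := @ereal_nonincreasing_cvgn R (fun t => (f (theta t))%:E).
suff -> : ereal_inf (range (fun t => (f (theta t))%:E)) = inf_value f.
  by apply=> m n mn; rewrite lee_fin; exact: descent_nonincreasing.
set m := ereal_inf _.
have m_le t : (m <= (f (theta t))%:E)%E by apply: ereal_inf_lbound; exists t.
apply/le_anti/andP; split; last first.
  by apply: le_ereal_inf_tmp => _ [t _ <-]; exact: inf_value_le.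
apply: le_ereal_inf_tmp => _ [z _ <-]; rewrite leNgt; apply/negP => zm.
have : exists2 delta : R, 0 < delta & forall t, delta <= f (theta t) - f z.
  case: m m_le zm => [r| |] m_le zm.
  - exists (r - f z); first by rewrite subr_gt0 -lte_fin.
    by move=> t; rewrite lerD2r -lee_fin.
  - by have := m_le 0%N.
  - by [].
move=> [delta delta0 gap].
suff : (\sum_(0 <= t <oo) (eta t)%:E <=
    (l2norm (theta 0%N - z) ^+ 2 / (2 * delta))%:E)%E.
  by rewrite eta_diverges.
apply: lime_le.
  by apply: is_cvg_nneseries => t _ _; rewrite lee_fin ltW.
apply: nearW => T; rewrite sumEFin lee_fin ler_pdivlMr ?mulr_gt0// mulrC.
exact: descent_rate.
Qed.

Lemma descent_fejer s : solution_set f s ->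
  nonincreasing_seq (fun t => l2norm (theta t - s)).
Proof.
move=> /solution_setP smin; apply/nonincreasing_seqP => t.
rewrite -(@ler_pXn2r _ 2) ?nnegrE ?l2norm_ge0//.
apply: (le_trans (step_dist t s)).
by rewrite lerBlDr lerDl !mulr_ge0 ?subr_ge0// ltW.
Qed.

(** A cluster point [q] is the limit of a filter [G] finer than the iterates.
Along [G] the values tend both to [f q], by continuity, and to the infimum. *)
Lemma descent_cvg : continuous f -> solution_set f !=set0 ->
  exists2 q, solution_set f q & theta t @[t --> \oo] --> q.
Proof.
move=> fc S0; apply: (fejer_cvg _ _ S0 descent_fejer).
rewrite cluster_cvgE => q [G GP [Gq thetaG]].
have fGq : (f x)%:E @[x --> G] --> (f q)%:E.
  by apply: cvg_EFin; [exact: nearW | exact: cvg_comp Gq (fc q)].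
have fGinf : (f x)%:E @[x --> G] --> inf_value f.
  by move=> V /descent_cvg_inf; exact: thetaG.
exact: cvg_unique fGq fGinf.
Qed.

End Descent.

Theorem corollary2 (R : realType) (d : nat) (f : 'rV[R]_d -> R) (L : R)
    (eta : nat -> R) (theta : nat -> 'rV[R]_d)
    (f_convex : convex_function [set: convex_lmodType 'rV[R]_d] f)
    (f_diff : forall x : 'rV[R]_d, differentiable (f : 'rV[R]_d -> R^o) x)
    (L_gt0 : 0 < L)
    (f_smooth : l2_smooth L f)
    (eta_bound : forall t : nat, 0 < eta t <= 1 / L)
    (theta_step : forall t : nat,
       theta t.+1 = theta t - eta t *: gradient f (theta t)) :
  let S := solution_set f in
  let eta_diverges := (\sum_(0 <= t <oo) (eta t)%:E = +oo)%E in
  let theta_oo := lim (theta t @[t --> \oo]) in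
  (closed S /\ convex_set (S : set (convex_lmodType 'rV[R]_d)))
  /\ (eta_diverges -> (f (theta t))%:E @[t --> \oo] --> inf_value f)
  /\ (S !=set0 ->
        (forall s : 'rV[R]_d, S s ->
           nonincreasing_seq (fun t : nat => l2norm (theta t - s)))
        /\ nonincreasing_seq (fun t : nat => l2dist S (theta t)))
  /\ (S !=set0 -> eta_diverges ->
        (theta t @[t --> \oo] --> theta_oo)
        /\ S theta_oo
        /\ l2norm (theta_oo - l2proj S (theta 0%N)) <= l2dist S (theta 0%N)
        /\ l2norm (theta_oo - theta 0%N) <= 2 * l2dist S (theta 0%N))
  /\ (S !=set0 -> eta_diverges -> affine_set S ->
        theta_oo = l2proj S (theta 0%N)).
Proof.
move=> S eta_diverges theta_oo.
have fc : continuous f by move=> x; exact: differentiable_continuous (f_diff x).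
have eta_gt0 t : 0 < eta t by have /andP[] := eta_bound t.
have step t z : l2norm (theta t.+1 - z) ^+ 2 <=
    l2norm (theta t - z) ^+ 2 - 2 * eta t * (f (theta t.+1) - f z).
  by rewrite theta_step; exact: gradient_step_dist.
have Sclosed : closed S by exact: closed_solution_set.
have fejer := descent_fejer f eta theta eta_gt0 step.
have limP : S !=set0 -> eta_diverges ->
    theta t @[t --> \oo] --> theta_oo /\ S theta_oo.
  move=> S0 eta_div.
  have [q Sq qlim] := descent_cvg f eta theta eta_gt0 step eta_div fc S0.
  by rewrite /theta_oo (cvg_lim _ qlim).
have lim_le s : S !=set0 -> eta_diverges -> S s ->
    l2norm (theta_oo - s) <= l2norm (theta 0%N - s).
  move=> S0 eta_div Ss; have [cvgt _] := limP S0 eta_div.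
  apply: (@cvgr_to_le _ \oo _ _ (fun t => l2norm (theta t - s))).
    exact: cvg_comp cvgt (l2normB_continuous s theta_oo).
  by apply: nearW => t; exact: fejer.
split; first by split => //; exact: convex_solution_set.
split; first by move=> eta_div; exact: descent_cvg_inf.
split.
  move=> S0; split => // m n mn.
  have [Sp _] := l2projP S (theta m) Sclosed S0.
  have [_ pmin] := l2projP S (theta n) Sclosed S0.
  rewrite !l2distE//; exact: le_trans (pmin _ Sp) (fejer _ Sp _ _ mn).
split.
  move=> S0 eta_div; have [cvgt Soo] := limP S0 eta_div.
  have [Sp _] := l2projP S (theta 0%N) Sclosed S0.
  have proj_le := lim_le _ S0 eta_div Sp.
  rewrite l2distE//; do 3 split => //.
  rewrite -(subrKA (l2proj S (theta 0%N))) mulr2n mulrDl mul1r.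
  by rewrite (le_trans (l2normD _ _))// lerD// l2normBC.
move=> S0 eta_div Saff; have [_ Soo] := limP S0 eta_div.
by apply: affine_nonexpansive_l2proj => // s; exact: lim_le.
Qed.
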